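(* Let $\mathbb Y$ be a normed space with $\dim\mathbb Y\ge2$, $I:\mathbb Y\to\mathbb Y$ the identity, and $Q:\mathbb Y\to\mathbb Y$ a (possibly nonlinear) operator such that: (i) $Q$ is a nontrivial projector: $0\ne Q=Q\circ Q\ne I$; (ii) $Q$ is homogeneous: $Q(\lambda y)=\lambda Q(y)$ for all $y\in\mathbb Y$ and $\lambda\in\mathbb R$; (iii) $Q$ is bounded: $\|Q\|:=\sup_{y\in\mathbb Y\setminus\{0\}}\|Q(y)\|_{\mathbb Y}/\|y\|_{\mathbb Y}<+\infty$; (iv) $Q$ is a generalized orthogonal projector: $Q(y)=Q\bigl(Q(y)+\eta\,(I-Q)(y)\bigr)$ for any $\eta\in\mathbb R$ and any $y\in\mathbb Y$. Then the nonlinear operator $I-Q$ is also bounded and satisfies $$\|I-Q\|\le C_{\mathrm S}\,\|Q\|,\qquad C_{\mathrm S}:=\min\bigl\{1+\|Q\|^{-1},\,C_{\mathrm{BM}}(\mathbb Y)\bigr\},$$ where $\|I-Q\|:=\sup_{y\in\mathbb Y\setminus\{0\}}\|y-Q(y)\|_{\mathbb Y}/\|y\|_{\mathbb Y}$ and $C_{\mathrm{BM}}(\mathbb Y)$ is the Banach--Mazur constant of $\mathbb Y$.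
   Context: All spaces are real. Banach--Mazur constant (for $\dim\mathbb Y\ge2$): $C_{\mathrm{BM}}(\mathbb Y):=\sup\{d_{\mathrm{BM}}(\mathbb W,\ell_2(\mathbb R^2))^2:\mathbb W\subset\mathbb Y\text{ a subspace},\ \dim\mathbb W=2\}$, where $d_{\mathrm{BM}}(\mathbb W,\ell_2(\mathbb R^2)):=\inf\{\|T\|\,\|T^{-1}\|: T:\mathbb W\to\ell_2(\mathbb R^2)\text{ a linear isomorphism}\}$ and $\ell_2(\mathbb R^2)$ is $\mathbb R^2$ with the Euclidean norm. It is known that $1\le C_{\mathrm{BM}}(\mathbb Y)\le2$. *)

(* Defs.v *)
From mathcomp Require Import all_boot all_order all_algebra.
From mathcomp Require Import all_classical all_reals all_analysis.

Set Implicit Arguments.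
Unset Strict Implicit.
Unset Printing Implicit Defensive.

Import Order.TTheory GRing.Theory Num.Theory.
Import numFieldNormedType.Exports.
Local Open Scope classical_set_scope.
Local Open Scope ring_scope.

(* The supremum of ratios is taken in [\bar R], so that an unbounded map has
   norm [+oo] and no default value occurs. The norms [nU] and [nV] are
   arguments because the library's own norm on ['rV[R]_n] is the maximum norm,
   not the Euclidean one. *)
Definition opnorm (R : realType) (U V : zmodType) (nU : U -> R) (nV : V -> R)
    (D : set U) (f : U -> V) : \bar R :=
  ereal_sup [set (nV (f x) / nU x)%:E | x in [set x | D x /\ x != 0]].

Definition l2norm (R : realType) (n : nat) (v : 'rV[R]_n) : R :=
  Num.sqrt (\sum_(i < n) v 0 i ^+ 2).

Definition lin_indep (R : realType) (Y : lmodType R) (n : nat)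
    (e : 'I_n -> Y) : Prop :=
  forall a : 'I_n -> R, \sum_(i < n) a i *: e i = 0 -> forall i, a i = 0.

Definition dim_ge (R : realType) (Y : lmodType R) (n : nat) : Prop :=
  exists e : 'I_n -> Y, lin_indep e.

Definition subspace_of_dim (R : realType) (Y : lmodType R) (n : nat)
    (W : set Y) : Prop :=
  submod_closed [in W] /\
  exists e : 'I_n -> Y,
    [/\ forall i, W (e i), lin_indep e &
        forall w, W w -> exists a : 'I_n -> R, w = \sum_(i < n) a i *: e i].

(* [T] restricted to [W] is a linear isomorphism onto [V] with inverse [S];
   the values of [T] outside [W] are irrelevant. *)
Definition lin_iso (R : realType) (Y V : lmodType R) (W : set Y)
    (T : Y -> V) (S : V -> Y) : Prop :=
  [/\ forall (a : R) u v, W u -> W v -> T (a *: u + v) = a *: T u + T v,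
      forall v, W (S v),
      forall w, W w -> S (T w) = w &
      forall v, T (S v) = v].

Section BanachMazur.
Context (R : realType) (Y : normedModType R).

Definition dBM_l2 (W : set Y) : \bar R :=
  ereal_inf [set d : \bar R |
    exists (T : Y -> 'rV[R]_2) (S : 'rV[R]_2 -> Y), lin_iso W T S /\
      d = (opnorm Num.norm (@l2norm R 2) W T *
           opnorm (@l2norm R 2) Num.norm setT S)%E].

Definition CBM : \bar R :=
  ereal_sup [set (dBM_l2 W ^+ 2)%E | W in [set W : set Y | subspace_of_dim 2 W]].

End BanachMazur.
Arguments CBM {R} Y.

(* Main.v *)
Require Import Defs.
From mathcomp Require Import all_boot all_order all_algebra.
From mathcomp Require Import all_classical all_reals all_analysis.
From mathcomp Require Import ring lra.

Set Implicit Arguments.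
Unset Strict Implicit.
Unset Printing Implicit Defensive.

Import Order.TTheory GRing.Theory Num.Theory.
Import numFieldNormedType.Exports.
Local Open Scope classical_set_scope.
Local Open Scope ring_scope.

(** Fix [y] with [u = Q y] and [v = y - Q y] both nonzero. Homogeneity and (iv)
    show that, on the plane [W] spanned by [u] and [v], the linear projection
    onto [u] along [v] is bounded by [||Q||]. A nontrivial projection of a
    Euclidean space and its complementary projection have the same norm;
    transporting this through an isomorphism [T : W -> l2] costs a factor
    [(||T|| ||T^-1||)^2], and the infimum over [T] gives [C_BM]. The degenerate
    cases use [C_BM >= 1], and the bound [1 + 1/||Q||] is the triangle
    inequality. *)

Section EuclideanNorm.
Context {R : realType} {n : nat}.
Implicit Types a b : 'rV[R]_n.

Lemma l2norm_ge0 a : 0 <= l2norm a.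
Proof. exact: sqrtr_ge0. Qed.

Lemma sqr_l2norm a : l2norm a ^+ 2 = \sum_(i < n) a 0 i ^+ 2.
Proof. by rewrite sqr_sqrtr// sumr_ge0// => i _; exact: sqr_ge0. Qed.

Lemma l2norm0 : l2norm (0 : 'rV[R]_n) = 0.
Proof.
by rewrite /l2norm big1 ?sqrtr0// => i _; rewrite mxE expr0n.
Qed.

Lemma l2norm_gt0 a : a != 0 -> 0 < l2norm a.
Proof.
move=> a0; rewrite lt0r l2norm_ge0 andbT; apply: contra_neq a0 => a0.
have /eqP := sqr_l2norm a; rewrite a0 expr0n/= eq_sym psumr_eq0; last first.
  by move=> i _; exact: sqr_ge0.
move=> /allP h; apply/rowP => i; rewrite mxE.
by apply/eqP; have := h i; rewrite mem_index_enum/= sqrf_eq0; exact.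
Qed.

Lemma sqr_l2norm_lin (x y : R) a b :
  l2norm (x *: a + y *: b) ^+ 2 =
  x ^+ 2 * l2norm a ^+ 2 + 2 * x * y * (\sum_(i < n) a 0 i * b 0 i)
  + y ^+ 2 * l2norm b ^+ 2.
Proof.
rewrite !sqr_l2norm !mulr_sumr -!big_split/=; apply: eq_bigr => i _.
by rewrite !mxE; ring.
Qed.

(* The hypothesis, tested at the point of [a + span b] nearest to [0], bounds
   [|a|^2 |b|^2] by [k^2] times the Gram determinant, a symmetric condition
   in [a] and [b]. *)
Lemma l2norm_complementary_projection (k : R) a b : a != 0 -> b != 0 -> 0 <= k ->
  (forall x y : R, l2norm (x *: a) <= k * l2norm (x *: a + y *: b)) ->
  l2norm b <= k * l2norm (a + b).
Proof.
move=> /l2norm_gt0 a0 /l2norm_gt0 b0 k0 proj_le.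
rewrite -ler_sqr ?nnegrE ?mulr_ge0 ?l2norm_ge0// exprMn.
have := sqr_l2norm_lin 1 1 a b; rewrite !scale1r => ->.
set c := \sum_(i < n) _; set A := l2norm a in a0 *; set B := l2norm b in b0 *.
have A2 : 0 < A ^+ 2 by rewrite exprn_gt0.
have B2 : 0 < B ^+ 2 by rewrite exprn_gt0.
have gram : A ^+ 2 * B ^+ 2 <= k ^+ 2 * (A ^+ 2 * B ^+ 2 - c ^+ 2).
  (* The nearest point is [a - (c / B ^+ 2) *: b]. Scaling it by [B ^+ 2] avoids the division, and
     its squared norm becomes [B ^+ 2 * (A ^+ 2 * B ^+ 2 - c ^+ 2)]. *)
  have := proj_le (B ^+ 2) (- c).
  rewrite -ler_sqr ?nnegrE ?mulr_ge0 ?l2norm_ge0// exprMn sqr_l2norm_lin.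
  have := sqr_l2norm_lin (B ^+ 2) 0 a b; rewrite scale0r addr0 => ->.
  rewrite -/A -/B -/c -(ler_pM2l B2) => h; rewrite -(ler_pM2l B2) -(ler_pM2l B2).
  by lra.
(* The Gram determinant equals [A ^+ 2 * l2norm (a + b) ^+ 2 - (A ^+ 2 + c) ^+ 2]; dropping the last
   square gives the claim. *)
rewrite -(ler_pM2l A2); apply: (le_trans gram).
have := mulr_ge0 (sqr_ge0 k) (sqr_ge0 (A ^+ 2 + c)).
by move: (A ^+ 2) (B ^+ 2) (k ^+ 2) => X Z K; nra.
Qed.

End EuclideanNorm.

Section OperatorNorm.
Context {R : realType} {U V : zmodType} (nU : U -> R) (nV : V -> R).
Context (D : set U) (f : U -> V).

Lemma opnorm_ratio_le x : D x -> x != 0 ->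
  ((nV (f x) / nU x)%:E <= opnorm nU nV D f)%E.
Proof. by move=> Dx x0; apply: ereal_sup_ubound; exists x. Qed.

Lemma le_opnorm (c : R) x : opnorm nU nV D f = c%:E ->
  D x -> x != 0 -> 0 < nU x -> nV (f x) <= c * nU x.
Proof.
move=> fc Dx x0 x_gt0; have := opnorm_ratio_le Dx x0.
by rewrite fc lee_fin ler_pdivrMr.
Qed.

End OperatorNorm.

Section BanachMazurLowerBound.
Context {R : realType} {Y : normedModType R}.

Lemma subspace0 (n : nat) (W : set Y) : subspace_of_dim n W -> W 0.
Proof. by move=> [[W0 _] _]; move: W0; rewrite inE. Qed.

Lemma subspace_neq0 (n : nat) (W : set Y) : (0 < n)%N -> subspace_of_dim n W ->
  exists2 w, W w & w != 0.
Proof.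
case: n => // n _ [_ [e [We indep _]]]; exists (e ord0) => //.
apply/eqP => e0; have := indep (fun i => (i == ord0)%:R).
have -> : \sum_(i < n.+1) (i == ord0)%:R *: e i = 0.
  by rewrite (bigD1 ord0)//= e0 scaler0 add0r big1// => i /negPf->; rewrite scale0r.
by move=> /(_ erefl ord0)/eqP; rewrite eqxx oner_eq0.
Qed.

Lemma lin_iso0 (W : set Y) (T : Y -> 'rV[R]_2) S : W 0 -> lin_iso W T S -> T 0 = 0.
Proof.
move=> W0 [T_lin _ _ _]; have := T_lin 1 0 0 W0 W0.
by rewrite !scale1r addr0 => /esym/eqP; rewrite -subr_eq0 addrK => /eqP.
Qed.

Lemma lin_iso_neq0 (W : set Y) (T : Y -> 'rV[R]_2) S w : W 0 -> lin_iso W T S ->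
  W w -> w != 0 -> T w != 0.
Proof.
move=> W0 iso Ww; apply: contra_neq => Tw0; have [_ _ ST _] := iso.
by rewrite -(ST w Ww) Tw0 -(lin_iso0 W0 iso) ST.
Qed.

(** Reduces a lower bound on [CBM Y] to real bounds [t], [s] for a single isomorphism: an infinite
    operator norm makes the product [+oo], and the square root of [r] is compared with each product
    before the infimum is taken. *)
Lemma CBM_ge (W : set Y) (r : R) : subspace_of_dim 2 W -> 0 <= r ->
  (forall (T : Y -> 'rV[R]_2) S (t s : R), lin_iso W T S -> 0 <= t -> 0 <= s ->
    (forall w, W w -> l2norm (T w) <= t * `|w|) ->
    (forall v, `|S v| <= s * l2norm v) -> r <= (s * t) ^+ 2) ->
  (r%:E <= CBM Y)%E.
Proof.
move=> dimW r0 H; have W0 := subspace0 dimW.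
apply: (@le_trans _ _ (dBM_l2 W ^+ 2)%E); last first.
  by apply: ereal_sup_ubound; exists W.
have : ((Num.sqrt r)%:E <= dBM_l2 W)%E.
  apply: le_ereal_inf_tmp => _ [T [S [iso ->]]].
  have [_ WS ST TS] := iso.
  have [w Ww w0] := @subspace_neq0 2 W isT dimW.
  have Tw0 := lin_iso_neq0 W0 iso Ww w0.
  (* Both norms are positive, so an infinite factor cannot meet a zero one, where the product would
     be [0]. *)
  have tP : (0 < opnorm Num.norm (@l2norm R 2) W T)%E.
    apply: (lt_le_trans _ (opnorm_ratio_le _ _ _ Ww w0)).
    by rewrite lte_fin divr_gt0 ?normr_gt0 ?l2norm_gt0.
  have sP : (0 < opnorm (@l2norm R 2) Num.norm setT S)%E.
    apply: (lt_le_trans _ (opnorm_ratio_le _ _ _ (I : setT (T w)) Tw0)).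
    by rewrite lte_fin ST// divr_gt0 ?normr_gt0 ?l2norm_gt0.
  case tE : (opnorm _ _ W T) tP => [t||]// t0; last first.
    by rewrite gt0_mulye// leey.
  case sE : (opnorm _ _ _ S) sP => [s||]// s0; last first.
    by rewrite gt0_muley// leey.
  rewrite !lte_fin in t0 s0.
  rewrite -EFinM lee_fin -(ger0_norm (mulr_ge0 (ltW t0) (ltW s0))) -sqrtr_sqr.
  rewrite ler_sqrt ?sqr_ge0// (mulrC t); apply: (H T S) => //.
  - exact: ltW.
  - exact: ltW.
  - move=> z Wz; have [->|z0] := eqVneq z 0.
      by rewrite (lin_iso0 W0 iso) l2norm0 normr0 mulr0.
    by apply: (le_opnorm tE) => //; rewrite normr_gt0.
  - move=> z; have [->|z0] := eqVneq z 0.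
      (* [lin_iso] states linearity of [T] only, so [S 0 = 0] is read off from [S (T 0) = 0]. *)
      by rewrite -[X in S X](lin_iso0 W0 iso) ST// normr0 l2norm0 mulr0.
    by apply: (le_opnorm sE) => //; exact: l2norm_gt0.
case: (dBM_l2 W) => [d||]//.
- rewrite -EFin_expe !lee_fin => rd.
  by rewrite -(sqr_sqrtr r0) ler_pXn2r// nnegrE ?sqrtr_ge0// (le_trans _ rd)// sqrtr_ge0.
- by move=> _; rewrite expe2 mulyy leey.
Qed.

Definition span {n : nat} (e : 'I_n -> Y) : set Y :=
  [set w | exists a : 'I_n -> R, w = \sum_(i < n) a i *: e i].

Lemma subspace_span (n : nat) (e : 'I_n -> Y) : lin_indep e ->
  subspace_of_dim n (span e).
Proof.
move=> indep; split; first split.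
- by rewrite inE; exists (fun=> 0); rewrite big1// => i _; rewrite scale0r.
- move=> c u v; rewrite !inE => -[a ->] [b ->].
  exists (fun i => c * a i + b i); rewrite scaler_sumr -big_split/=.
  by apply: eq_bigr => i _; rewrite scalerA scalerDl.
- exists e; split => // i; exists (fun j => (j == i)%:R).
  by rewrite (bigD1 i)//= eqxx scale1r big1 ?addr0// => j /negPf->; rewrite scale0r.
Qed.

(** Going to the Euclidean plane and back fixes a nonzero [w], so [s * t] is at least [1]. *)
Lemma CBM_ge1 : dim_ge Y 2 -> (1 <= CBM Y)%E.
Proof.
move=> [e /subspace_span dimW]; apply: (CBM_ge dimW) => // T S t s iso t0 s0 Tt Ss.
have [w Ww w0] := @subspace_neq0 2 _ isT dimW; have [_ _ ST _] := iso.
rewrite -normr_gt0 in w0; rewrite exprn_ege1// -(ler_pM2r w0) mul1r -[leLHS]/(`|w|).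
rewrite -[X in `|X| <= _](ST _ Ww); apply: (le_trans (Ss _)).
by rewrite -mulrA ler_wpM2l// Tt.
Qed.

End BanachMazurLowerBound.

Lemma lin_indep_pair {R : realType} {Y : lmodType R} (u v : Y) :
  u != 0 -> (forall c : R, v <> c *: u) ->
  lin_indep (fun i : 'I_2 => if i == ord0 then u else v).
Proof.
move=> u0 vu a; rewrite !big_ord_recl big_ord0/= addr0 => xy.
have y0 : a (lift ord0 ord0) = 0.
  apply/eqP/negP => /negP y0.
  apply: (vu (- ((a (lift ord0 ord0))^-1 * a ord0))).
  rewrite -[LHS]scale1r -(mulVf y0) -scalerA.
  have -> : a (lift ord0 ord0) *: v = - (a ord0 *: u).
    by apply/eqP; rewrite -addr_eq0 addrC xy.
  by rewrite scalerN scalerA scaleNr.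
move: xy; rewrite y0 scale0r addr0 => /eqP.
rewrite scaler_eq0 (negPf u0) orbF => /eqP x0 i.
by case: (unliftP ord0 i) => [j ->|->//]; rewrite (ord1 j).
Qed.

(** The projection onto [u] along [v], bounded by [q], becomes one bounded by [t * q * s] in the
    Euclidean plane, and so does its complement. Carrying the complement back costs [s * t] once
    more, whence [q * (s * t) ^+ 2]. *)
Lemma complementary_ratio_le_CBM {R : realType} {Y : normedModType R} (u v : Y)
    (q : R) : u != 0 -> v != 0 -> 0 < q ->
  (forall x y : R, `|x *: u| <= q * `|x *: u + y *: v|) ->
  ((`|v| / `|u + v| / q)%:E <= CBM Y)%E.
Proof.
move=> u0 v0 q0 proj_le.
have vu c : v <> c *: u.
  move=> vE; have c0 : c != 0 by apply: contra_neq v0 => c0; rewrite vE c0 scale0r.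
  (* If [v = c *: u], then [u - c^-1 *: v] vanishes and the hypothesis forces [u = 0]. *)
  have := proj_le 1 (- c^-1).
  rewrite vE scalerA mulNr mulVf// scaleNr subrr normr0 mulr0 scale1r.
  by rewrite normr_le0 (negPf u0).
have uv0 : 0 < `|u + v|.
  have := proj_le 1 1; rewrite !scale1r => h.
  by rewrite -(pmulr_rgt0 _ q0) (lt_le_trans _ h)// normr_gt0.
set e := fun i : 'I_2 => if i == ord0 then u else v.
have dimW : subspace_of_dim 2 (span e).
  by apply: subspace_span; exact: lin_indep_pair.
have Wuv x y : span e (x *: u + y *: v).
  exists (fun i => if i == ord0 then x else y).
  by rewrite !big_ord_recl big_ord0/= addr0.
have Wu : span e u by have := Wuv 1 0; rewrite scale1r scale0r addr0.
have Wv : span e v by have := Wuv 0 1; rewrite scale1r scale0r add0r.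
have W0 := subspace0 dimW.
apply: (CBM_ge dimW); first by rewrite !divr_ge0// ltW.
move=> T S t s iso t0 s0 Tt Ss; have [T_lin _ ST _] := iso.
have Tuv x y : T (x *: u + y *: v) = x *: T u + y *: T v.
  have Wyv : span e (y *: v) by have := Wuv 0 y; rewrite scale0r add0r.
  rewrite T_lin//; congr (_ + _).
  by have := T_lin y v 0 Wv W0; rewrite (lin_iso0 W0 iso) !addr0.
have := @l2norm_complementary_projection _ _ (t * q * s) (T u) (T v)
  (lin_iso_neq0 W0 iso Wu u0) (lin_iso_neq0 W0 iso Wv v0).
have h x y : l2norm (x *: T u) <= t * q * s * l2norm (x *: T u + y *: T v).
  rewrite -Tuv; have := Tuv x 0; rewrite !scale0r !addr0 => <-.
  have Wxu : span e (x *: u) by have := Wuv x 0; rewrite scale0r addr0.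
  apply: (le_trans (Tt _ Wxu)); rewrite -!mulrA ler_wpM2l//.
  apply: (le_trans (proj_le x y)); rewrite ler_wpM2l//; first exact: ltW.
  by rewrite -[X in `|X|](ST _ (Wuv x y)).
move=> /(_ _ h); rewrite !mulr_ge0// ?(ltW q0)// => /(_ isT) TvT.
rewrite !ler_pdivrMr// -[X in `|X| <= _](ST _ Wv).
apply: (le_trans (Ss _)).
rewrite (_ : _ * _ * _ = s * (t * q * s * (t * `|u + v|))); last by ring.
rewrite ler_wpM2l//; apply: (le_trans TvT); rewrite ler_wpM2l//.
  by rewrite !mulr_ge0// ltW.
have := Tuv 1 1; rewrite !scale1r => <-; apply: Tt.
by have := Wuv 1 1; rewrite !scale1r.
Qed.

Theorem lemma2p9 (R : realType) (Y : normedModType R) (Q : Y -> Y)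
    (dimY : dim_ge Y 2)
    (Q_neq0 : Q <> (fun=> 0)) (Q_idem : Q \o Q = Q) (Q_neqI : Q <> id)
    (Q_hom : forall (y : Y) (lambda : R), Q (lambda *: y) = lambda *: Q y)
    (Q_bnd : (opnorm Num.norm Num.norm setT Q < +oo)%E)
    (Q_gop : forall (eta : R) (y : Y), Q y = Q (Q y + eta *: (y - Q y))) :
  let normQ := opnorm Num.norm Num.norm setT Q in
  let normIQ := opnorm Num.norm Num.norm setT (fun y => y - Q y) in
  let CS := Order.min (1 + normQ^-1)%E (CBM Y) in
  (normIQ < +oo)%E /\ (normIQ <= CS * normQ)%E.
Proof.
move=> normQ normIQ CS.
have Q0 : Q 0 = 0 by rewrite -[X in Q X](scale0r (0 : Y)) Q_hom scale0r.
have [z Qz0] : exists z, Q z != 0.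
  apply: contrapT => /forallNP h; apply: Q_neq0; apply/funext => z.
  by apply/eqP/negP => /negP; exact: h.
(* [Q] fixes the nonzero vector [Q z]. This bound makes [normQ^-1] a genuine inverse and settles the
   case [Q y = 0] below. *)
have normQ_ge1 : (1 <= normQ)%E.
  have := opnorm_ratio_le Num.norm Num.norm Q (I : setT (Q z)) Qz0.
  by rewrite -[Q (Q z)]/((Q \o Q) z) Q_idem divff ?normr_eq0.
have [q qE q1] : exists2 q : R, normQ = q%:E & 1 <= q.
  move: normQ_ge1 Q_bnd; rewrite -/normQ.
  by case: (normQ) => [q||]//; rewrite lee_fin => q1 _; exists q.
have q0 : 0 < q by rewrite (lt_le_trans ltr01).
have Qle y : `|Q y| <= q * `|y|.
  have [->|y0] := eqVneq y 0; first by rewrite Q0 normr0 mulr0.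
  by apply: (le_opnorm qE) => //; rewrite normr_gt0.
have leS : (normIQ <= (1 + normQ^-1) * normQ)%E.
  rewrite qE inver gt_eqF// -EFinD -EFinM mulrDl mul1r mulVf ?gt_eqF//.
  apply: ge_ereal_sup => _ [y [_ y0] <-].
  rewrite lee_fin ler_pdivrMr ?normr_gt0//.
  by apply: (le_trans (ler_normB _ _)); rewrite mulrDl mul1r addrC lerD2r.
have leBM : (normIQ <= CBM Y * normQ)%E.
  rewrite qE; apply: ge_ereal_sup => _ [y [_ y0] <-].
  rewrite -lee_pdivrMr// -EFinM.
  have le1 (r : R) : r <= 1 -> (r%:E <= CBM Y)%E.
    by move=> r1; apply: le_trans (CBM_ge1 dimY); rewrite lee_fin.
  have [yQ|v0] := eqVneq (y - Q y) 0.
    by apply: le1; rewrite yQ normr0 !mul0r.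
  have [Qy|u0] := eqVneq (Q y) 0.
    by apply: le1; rewrite Qy subr0 divff ?normr_eq0// mul1r invf_le1.
  have := @complementary_ratio_le_CBM R Y (Q y) (y - Q y) q u0 v0 q0.
  rewrite (addrC (Q y) (y - Q y)) subrK; apply => a b.
  have [->|a0] := eqVneq a 0.
    by rewrite scale0r normr0 mulr_ge0// ltW.
  (* Homogeneity takes [a] out of [Q], and (iv) with [eta = b / a] leaves [a *: Q y]: on this plane
     the nonlinear [Q] acts as the linear projection, at least for nonzero [a]. *)
  have -> : a *: Q y + b *: (y - Q y) = a *: (Q y + (b / a) *: (y - Q y)).
    by rewrite [RHS]scalerDr scalerA mulrC divfK.
  have := Qle (a *: (Q y + (b / a) *: (y - Q y))).
  by rewrite Q_hom -Q_gop.
split; last by rewrite /CS /Order.min; case: ifP.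
(* The right-hand side of [leS] is the real number [q + 1]. *)
apply: (le_lt_trans leS).
by rewrite qE inver gt_eqF// -EFinD -EFinM ltry.
Qed.
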